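(* Let $k,s\ge 0$ and $n>1$ be integers and let $$P_{k,n}^{(s)}(x)=\sum_{j=0}^{n-1}T_{j(k+1)+s}(x),$$ i.e. the polynomial with Chebyshev coordinates $[\underbrace{0,\ldots,0}_{s},1,\underbrace{0,\ldots,0}_{k},1,\underbrace{0,\ldots,0}_{k},1,\ldots,1,\underbrace{0,\ldots,0}_{k},1]$, where $n$ is the number of entries equal to $1$. Then $P_{k,n}^{(s)}(x)$ is hyperbolic and all its roots lie in $[-2,2]$. Moreover, for fixed $k$ and $s$, as $n\to+\infty$ the largest root of $P_{k,n}^{(s)}(x)$ tends to $2$ and the smallest root tends to $-2$.
   Context: The Chebyshev polynomials used here are the monic integer polynomials $T_0(x)=1$ and, for $n>0$, $T_n(x)=x^n+\sum_{k=1}^{\lfloor n/2\rfloor}(-1)^k\frac nk\binom{n-k-1}{k-1}x^{n-2k}$; equivalently, for $n>0$, $T_n(2\cos\theta)=2\cos(n\theta)$ and $T_n(z+z^{-1})=z^n+z^{-n}$. Note the convention $T_0=1$ (not $2$). A polynomial has Chebyshev coordinates $[c_0,c_1,\ldots,c_d]$ if it equals $\sum_{j=0}^d c_jT_j(x)$. A real polynomial is called hyperbolic if all its complex roots are real. *)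

(* Defs.v *)
From HB Require Import structures.
From mathcomp Require Import all_boot all_order all_algebra.
From mathcomp Require Import complex.
From mathcomp Require Import all_classical all_reals all_analysis.

Set Implicit Arguments.
Unset Strict Implicit.
Unset Printing Implicit Defensive.

Import Order.TTheory GRing.Theory Num.Theory.
Import numFieldNormedType.Exports.

Local Open Scope ring_scope.

(* Monic Chebyshev polynomials, T_n(z + 1/z) = z^n + 1/z^n for n > 0, with the
   convention T_0 = 1 (not 2). *)
Definition chebT (F : numFieldType) (n : nat) : {poly F} :=
  if n is 0%N then 1 else
  'X^n + \sum_(1 <= k < (n %/ 2).+1)
           ((-1) ^+ k * (n%:R / k%:R) * 'C(n - k - 1, k - 1)%:R) *: 'X^(n - 2 * k).

(* [chebP F k s n] is P_{k,n}^{(s)}, with Chebyshev coordinates given by s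
   zeros followed by n ones, consecutive ones being separated by k zeros. *)
Definition chebP (F : numFieldType) (k s n : nat) : {poly F} :=
  \sum_(0 <= j < n) chebT F (j * k.+1 + s).

Definition hyperbolic (R : realType) (p : {poly R}) : Prop :=
  forall z : R[i], root (map_poly (real_complex R) p) z -> complex.Im z = 0.

Definition is_largest_root (R : realType) (p : {poly R}) (x : R) : Prop :=
  root p x /\ forall y : R, root p y -> y <= x.

Definition is_smallest_root (R : realType) (p : {poly R}) (x : R) : Prop :=
  root p x /\ forall y : R, root p y -> x <= y.

(* Main.v *)
Require Import Defs.
From mathcomp Require Import all_boot all_order all_algebra.
From mathcomp Require Import complex polyrcf ring lra zify.
From mathcomp Require Import all_classical all_reals all_analysis.
Import Order.TTheory GRing.Theory Num.Theory.
Import numFieldNormedType.Exports.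
Local Open Scope classical_set_scope.
Local Open Scope ring_scope.

(** Put x = z + 1/z, w = z^(k+1) and n = n' + 1.  Summing geometric series gives
    P(x) (w - 1) z^s w^n' = (w^n - 1) (z^(2s) w^n' + 1)   if s > 0,
    P(x) (w - 1) w^n' = w^(2n - 1) - 1                    if s = 0
    (the case s = 0 is different because T_0 = 1).  Hence P(x) = 0 forces
    |z| = 1, so that x = z + conj z = 2 Re z.  Conversely, with N = n (s > 0)
    or N = 2n - 1 (s = 0), every angle t with e^(i N (k+1) t) = 1 and
    e^(i (k+1) t) <> 1 gives the root 2 cos t; as n grows such angles come
    arbitrarily close to 0 and to pi. *)

(** * Chebyshev polynomials evaluated at [z + z^-1] *)

(* Values at x of the monic Chebyshev polynomials of the second kind U_n; they
   are used through T_n = U_n - U_(n-2) for n >= 2. *)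
Fixpoint chebU_val {F : fieldType} (x : F) (n : nat) : F :=
  match n with
  | 0 => 1
  | 1 => x
  | (m.+1 as m1).+1 => x * chebU_val x m1 - chebU_val x m
  end.

Lemma chebU_valSS (F : fieldType) (x : F) n :
  chebU_val x n.+2 = x * chebU_val x n.+1 - chebU_val x n.
Proof. by []. Qed.

(** Pascal's rule matches the recurrence. The bound [B] is left free because ['C(n - k, k)] vanishes
    once [2 * k > n]; this lets the sums for consecutive indices be aligned in the induction. *)
Lemma chebU_valE (F : fieldType) (x : F) n B : (n < B.*2)%N ->
  chebU_val x n = \sum_(k < B) (-1) ^+ k * 'C(n - k, k)%:R * x ^+ (n - 2 * k).
Proof.
suff H m : (forall B, (m < B.*2)%N -> chebU_val x m =
      \sum_(k < B) (-1) ^+ k * 'C(m - k, k)%:R * x ^+ (m - 2 * k)) /\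
    (forall B, (m.+1 < B.*2)%N -> chebU_val x m.+1 =
      \sum_(k < B) (-1) ^+ k * 'C(m.+1 - k, k)%:R * x ^+ (m.+1 - 2 * k)).
  by have [+ _] := H n; apply.
elim: m => [|m [IH0 IH1]].
  split=> -[|C] // _; rewrite big_ord_recl /= big1 ?addr0 ?muln0 ?subn0 ?mul1r //.
  - by move=> i _; rewrite sub0n bin_small // mulr0 mul0r.
  - by move=> i _; rewrite subSS sub0n bin_small // mulr0 mul0r.
split=> // -[|C] // ltmC; rewrite chebU_valSS (IH1 C.+1) 1?(IH0 C); try lia.
rewrite !big_ord_recl /= !muln0 !subn0 !bin0 !mul1r mulrDr -exprS -addrA.
congr (_ + _); rewrite mulr_sumr -sumrB; apply: eq_bigr => i _.
rewrite /bump /= !add1n [(-1) ^+ i.+1]exprS !mulN1r.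
have -> : (m.+2 - 2 * i.+1 = m - 2 * i)%N by lia.
rewrite !subSS.
(* Exponents agree when [2 * i < m]. Otherwise [m.+1 - 2 * i.+1] is truncated to 0, which is
   harmless since its coefficient ['C(m - i, i.+1)] is zero. *)
case: (ltngtP (2 * i) m) => [lt|gt|eq].
- have -> : (m.+1 - i = (m - i).+1)%N by lia.
  have -> : (m - 2 * i = (m.+1 - 2 * i.+1).+1)%N by lia.
  by rewrite binS natrD exprS; ring.
- by rewrite !bin_small ?(mulr0, mul0r, oppr0, subr0, addr0) //; lia.
- have -> : (m.+1 - i = i.+1)%N by lia.
  have -> : (m - i = i)%N by lia.
  by rewrite !binn bin_small //; ring.
Qed.

(** Write [n.+2] as [(n.+1 - k) + k.+1] and absorb [n.+1 - k] into the binomial. This splits a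
    coefficient of [T_(n+2)] into one of [U_(n+2)] and one of [U_n]. *)
Lemma natr_div_bin (F : numFieldType) n k : (2 * k <= n)%N ->
  n.+2%:R / k.+1%:R * 'C(n - k, k)%:R =
  'C(n.+1 - k, k.+1)%:R + 'C(n - k, k)%:R :> F.
Proof.
move=> le2kn; have k0 : k.+1%:R != 0 :> F by rewrite pnatr_eq0.
apply: (mulfI k0); rewrite mulrA mulrCA divff // mulr1 mulrDr -!natrM.
have := mul_bin_diag (n - k).+1 k.
rewrite [_.-1]/= -[(n - k).+1]subSn ?[(n.+1 - k)%N]subSn; try lia.
move=> <-; rewrite -natrD -mulnDl; congr (_ * _)%:R; lia.
Qed.

Lemma horner_chebTSS (F : numFieldType) (x : F) n :
  (chebT F n.+2).[x] = chebU_val x n.+2 - chebU_val x n.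
Proof.
rewrite /chebT hornerD hornerXn horner_sum.
have -> : (n.+2 %/ 2 = (n %/ 2).+1)%N by lia.
rewrite (chebU_valE _ _ n.+2 (n %/ 2).+2) 1?(chebU_valE _ _ n (n %/ 2).+1); try lia.
rewrite big_add1 big_mkord [in RHS]big_ord_recl /= mul1r bin0 mul1r muln0 subn0.
rewrite -addrA; congr (_ + _); rewrite -sumrB; apply: eq_bigr => i _.
have leI := ltn_ord i.
rewrite hornerZ hornerXn /bump /= !add1n.
have -> : (n.+2 - 2 * i.+1 = n - 2 * i)%N by lia.
have -> : (n.+2 - i.+1 - 1 = n - i)%N by lia.
rewrite !subSS subn0.
rewrite -[_ * _ * 'C(_, _)%:R]mulrA natr_div_bin; last lia.
by rewrite exprS; ring.
Qed.

Lemma horner_chebT (F : numFieldType) (z : F) n : z != 0 -> (0 < n)%N ->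
  (chebT F n).[z + z^-1] = z ^+ n + (z ^+ n)^-1.
Proof.
move=> z0; case: n => [//|[_|n _]].
  by rewrite /chebT divn_small // big_geq // addr0 hornerXn.
rewrite horner_chebTSS; set U := chebU_val _.
(* Both sides obey the same two-term recurrence in [n], so two consecutive cases are carried
   together. *)
suff [] : U n.+2 - U n = z ^+ n.+2 + (z ^+ n.+2)^-1 /\
  U n.+3 - U n.+1 = z ^+ n.+3 + (z ^+ n.+3)^-1 by [].
elim: n => [|n [IH0 IH1]]; first by rewrite /U /=; split; field.
split=> //.
transitivity ((z + z^-1) * (U n.+3 - U n.+1) - (U n.+2 - U n)).
  by rewrite {1}/U /= -/U; rewrite /U /= -/U; ring.
have zn0 : z ^+ n != 0 by rewrite expf_neq0.
by rewrite IH0 IH1 !exprS; field; rewrite z0 zn0.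
Qed.

(** * Closed forms of the sum and location of the complex roots *)

Lemma chebPS (F : numFieldType) k s n :
  chebP F k s n.+1 = chebP F k s n + chebT F (n * k.+1 + s).
Proof. by rewrite /chebP big_nat_recr. Qed.

Lemma chebP1 (F : numFieldType) k s : chebP F k s 1 = chebT F s.
Proof. by rewrite /chebP big_nat1. Qed.

(** Denominators are cleared so that the identity also covers [z ^+ k.+1 = 1], where the geometric
    sum formula would divide by zero. *)
Lemma horner_chebP_gt0 (F : numFieldType) (z : F) k s n : z != 0 -> (0 < s)%N ->
  (chebP F k s n.+1).[z + z^-1] * ((z ^+ k.+1 - 1) * (z ^+ s * z ^+ k.+1 ^+ n)) =
  (z ^+ k.+1 ^+ n.+1 - 1) * (z ^+ s ^+ 2 * z ^+ k.+1 ^+ n + 1).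
Proof.
move=> z0 s0.
have a0 : z ^+ s != 0 by rewrite expf_neq0.
elim: n => [|n IH]; first by rewrite chebP1 horner_chebT //; field.
rewrite chebPS hornerD horner_chebT // exprD [(n.+1 * _)%N]mulnC exprM.
rewrite !exprS in IH *.
have w0 : z ^+ k.+1 != 0 by rewrite expf_neq0.
rewrite exprS in w0.
set w := z * z ^+ k in IH w0 *; set b := w ^+ n in IH *.
have b0 : b != 0 by rewrite expf_neq0.
rewrite mulrDl; set P := horner _ _ in IH *.
rewrite (_ : P * _ = P * ((w - 1) * (z ^+ s * b)) * w); last by ring.
by rewrite IH; field; rewrite ?a0 ?w0 ?b0.
Qed.

(** As [T_0] is 1, the value is the symmetric sum of [w^j] for [-n <= j <= n], with [w = z ^+ k.+1]:
    a single geometric series. *)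
Lemma horner_chebP_0 (F : numFieldType) (z : F) k n : z != 0 ->
  (chebP F k 0 n.+1).[z + z^-1] * ((z ^+ k.+1 - 1) * z ^+ k.+1 ^+ n) =
  z ^+ k.+1 ^+ n.*2.+1 - 1.
Proof.
move=> z0.
elim: n => [|n IH]; first by rewrite chebP1 /chebT hornerC; ring.
rewrite chebPS hornerD horner_chebT // addn0 [(n.+1 * _)%N]mulnC exprM.
rewrite -!mul2n !(mulnC 2%N) !exprS !exprM !exprS in IH *.
have w0 : z ^+ k.+1 != 0 by rewrite expf_neq0.
rewrite exprS in w0.
set w := z * z ^+ k in IH w0 *; set b := w ^+ n in IH *.
have b0 : b != 0 by rewrite expf_neq0.
rewrite mulrDl; set P := horner _ _ in IH *.
rewrite (_ : P * _ = P * ((w - 1) * b) * w); last by ring.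
by rewrite IH; field; rewrite ?w0 ?b0.
Qed.

Lemma norm_eq1_of_chebP_root (F : numFieldType) (z : F) k s n :
  z != 0 -> root (chebP F k s n.+1) (z + z^-1) -> `|z| = 1.
Proof.
move=> z0 /rootP Pz0.
(* In every case some positive power of [z] turns out to be 1 or -1. *)
have norm1 m : (0 < m)%N -> `|z ^+ m| = 1 -> `|z| = 1.
  by move=> m0 /eqP; rewrite normrX pexpr_eq1 // => /eqP.
case: s Pz0 => [|s] Pz0.
  have /esym/eqP := horner_chebP_0 F z k n z0.
  rewrite Pz0 mul0r -exprM subr_eq0 => /eqP zN.
  by apply: (norm1 (k.+1 * n.*2.+1)%N); rewrite ?zN ?normr1.
have /esym/eqP := horner_chebP_gt0 F z k s.+1 n z0 isT.
rewrite Pz0 mul0r -!exprM -exprD mulf_eq0 subr_eq0 => /orP[]/eqP zN.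
  by apply: (norm1 (k.+1 * n.+1)%N); rewrite ?zN ?normr1.
apply: (norm1 (s.+1 * 2 + k.+1 * n)%N) => //.
by move/eqP: zN; rewrite addr_eq0 => /eqP ->; rewrite normrN1.
Qed.

Lemma map_chebP (F F' : numFieldType) (f : {rmorphism F -> F'}) k s n :
  map_poly f (chebP F k s n) = chebP F' k s n.
Proof.
rewrite rmorph_sum; apply: eq_bigr => j _; case: (_ + _)%N => [|m] /=.
  by rewrite rmorph1.
rewrite rmorphD rmorph_sum /= map_polyXn; congr (_ + _); apply: eq_bigr => i _.
rewrite map_polyZ map_polyXn !rmorphM rmorphXn rmorphN1 fmorphV.
by rewrite !rmorph_nat.
Qed.

Lemma ex_add_inv (R : realType) (x : R[i]) :
  exists2 z : R[i], z != 0 & x = z + z^-1.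
Proof.
(* [z] solves [z^2 - x z + 1 = 0]; the other solution [x - z] is its inverse. *)
pose y := sqrtc (x ^+ 2 - 4); pose z := (x + y) / 2.
have y2 : y ^+ 2 = x ^+ 2 - 4 by rewrite sqr_sqrtc.
have zz : z * (x - z) = 1.
  have -> : z * (x - z) = (x ^+ 2 - y ^+ 2) / 4 by rewrite /z; field.
  by rewrite y2; field.
have z0 : z != 0 by apply: contra_eqN zz => /eqP ->; rewrite mul0r eq_sym oner_neq0.
by exists z => //; apply: (mulfI z0); rewrite mulrDr divff // -zz; ring.
Qed.

Lemma chebP_complex_root (R : realType) k s n (x : R[i]) :
  root (chebP R[i] k s n.+1) x -> exists2 a : R, -2 <= a <= 2 & x = a%:C%C.
Proof.
have [z z0 ->] := ex_add_inv R x.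
move=> /(norm_eq1_of_chebP_root _ _ _ _ _ z0) z1.
exists (2 * complex.Re z).
  have : `|complex.Re z|%:C%C <= `|z| by exact: normc_ge_Re.
  rewrite z1 lecR ler_norml => /andP[]; lra.
by rewrite invc_norm z1 expr1n invr1 mul1r addcJ rmorphM rmorph_nat.
Qed.

(** * Real roots of the form [2 cos t] *)

Definition cis {R : realType} (t : R) : R[i] := (cos t +i* sin t)%C.

Lemma cisD (R : realType) (a b : R) : cis (a + b) = cis a * cis b.
Proof.
by rewrite /cis cosD sinD; apply/eqP; rewrite eq_complex /= eqxx addrC mulrC eqxx.
Qed.

Lemma cis0 (R : realType) : cis (0 : R) = 1.
Proof. by rewrite /cis cos0 sin0. Qed.

Lemma cisX (R : realType) (a : R) n : cis a ^+ n = cis (a *+ n).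
Proof. by elim: n => [|n IH]; rewrite ?cis0 // exprS IH -cisD mulrS. Qed.

Lemma cis_neq0 (R : realType) (a : R) : cis a != 0.
Proof.
apply/eqP => c0; have := cisD _ a (- a).
by rewrite subrr cis0 c0 mul0r => /eqP; rewrite oner_eq0.
Qed.

Lemma cisV (R : realType) (a : R) : (cis a)^-1 = cis (- a).
Proof.
by apply: (mulfI (cis_neq0 _ a)); rewrite -cisD subrr cis0 divff ?cis_neq0.
Qed.

Lemma cis_add_inv (R : realType) (a : R) : cis a + (cis a)^-1 = (2 * cos a)%:C%C.
Proof.
rewrite cisV /cis cosN sinN; apply/eqP; rewrite eq_complex /= subrr eqxx andbT.
by apply/eqP; ring.
Qed.

(** Passing to the half angle gives a test for [cis] to differ from 1, since [sin] is positive on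
    the open interval from 0 to [pi]. *)
Lemma cis_eq1_sin (R : realType) (a : R) : cis (a *+ 2) = 1 -> sin a = 0.
Proof.
case=> + _; rewrite cos_mulr2n cos2sin2 => h.
by apply/eqP; rewrite -sqrf_eq0; apply/eqP; lra.
Qed.

(** The right side of the closed form vanishes, while the factor multiplying the value of the
    polynomial does not. *)
Lemma chebP_root_cis (R : realType) k s n (t : R) :
  cis t ^+ k.+1 != 1 ->
  cis t ^+ k.+1 ^+ (if s is 0 then n.*2.+1 else n.+1) = 1 ->
  root (chebP R k s n.+1) (2 * cos t).
Proof.
move=> wn1 wN1; rewrite -(fmorph_root (real_complex R)) map_chebP.
rewrite -[_ (2 * cos t)]/((2 * cos t)%:C%C) -cis_add_inv.
have z0 := cis_neq0 _ t; apply/rootP.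
have w1 : cis t ^+ k.+1 - 1 != 0 by rewrite subr_eq0.
case: s wN1 => [|s] wN1.
  have := horner_chebP_0 _ _ k n z0; rewrite wN1 subrr => /eqP.
  by rewrite mulf_eq0 [X in _ || X]negbTE ?orbF 1?mulf_neq0 ?expf_neq0 // => /eqP.
have := horner_chebP_gt0 _ _ k s.+1 n z0 isT; rewrite wN1 subrr mul0r => /eqP.
by rewrite mulf_eq0 [X in _ || X]negbTE ?orbF ?mulf_neq0 ?expf_neq0 // => /eqP.
Qed.

(* Two consecutive multiples l d and (l+1) d of d = 2 pi / (N (k+1)) cannot
   both be excluded by the condition z^(k+1) <> 1, since otherwise
   e^(2 i pi / N) would be 1. *)
Lemma chebP_root_near (R : realType) k s n (t : R) : (0 < n)%N -> 0 <= t ->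
  exists2 a : R, `|t - a| <= pi *+ 2 / n.+1%:R & root (chebP R k s n.+1) (2 * cos a).
Proof.
move=> n0 t0; pose N := if s is 0 then n.*2.+1 else n.+1.
have ltnN : (n < N)%N by rewrite /N; case: (s) => [|?] //; lia.
have pi0 := pi_gt0 R; have pi20 : 0 < pi *+ 2 :> R by rewrite mulr2n addr_gt0.
pose d : R := pi *+ 2 / (N * k.+1)%:R.
have Nm0 : 0 < (N * k.+1)%:R :> R by rewrite ltr0n muln_gt0 (leq_trans _ ltnN).
have d0 : 0 < d by rewrite divr_gt0.
have leD : d <= pi *+ 2 / n.+1%:R.
  rewrite /d ler_pM2l // lef_pV2 ?posrE ?ltr0Sn // ler_nat.
  by rewrite (leq_trans ltnN) // leq_pmulr.
have dN : cis d ^+ k.+1 ^+ N = 1.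
  rewrite -exprM mulnC cisX -mulr_natr divfK ?gt_eqF //.
  by rewrite /cis cos2pi sin2pi.
(* The half angle is [pi / N], strictly below [pi] because [0 < n] forces [N >= 2]. *)
have dm : cis d ^+ k.+1 != 1.
  apply/eqP; rewrite cisX.
  have N0 : 0 < N%:R :> R by rewrite ltr0n (leq_trans _ ltnN).
  have -> : d *+ k.+1 = (pi / N%:R) *+ 2.
    rewrite /d natrM -mulr_natr -[RHS]mulr_natr -[pi *+ 2]mulr_natr.
    field; by rewrite gt_eqF // -mulrS pnatr_eq0.
  move=> /cis_eq1_sin /eqP; rewrite gt_eqF // sin_gt0_pi // divr_gt0 //=.
  by rewrite ltr_pdivrMr // ltr_pMr // ltr1n (leq_ltn_trans n0).
have root_l l : cis d ^+ k.+1 ^+ l != 1 -> root (chebP R k s n.+1) (2 * cos (d *+ l)).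
  move=> dl; apply: chebP_root_cis; rewrite -cisX [_ ^+ l ^+ _]exprAC //.
  by rewrite exprAC dN expr1n.
(* [d *+ l] is the last multiple of [d] not exceeding [t], so it and the next one are both within
   [d] of [t]. *)
pose l := Num.trunc (t / d).
have /andP[] : l%:R <= t / d < l.+1%:R by apply: trunc_itv; rewrite divr_ge0 // ltW.
rewrite ler_pdivlMr // ltr_pdivrMr // !mulr_natl => le_l lt_l.
have [dl|dl] := eqVneq (cis d ^+ k.+1 ^+ l) 1; last first.
  exists (d *+ l); last exact: root_l.
  apply: le_trans leD; rewrite ler_norml; apply/andP; split; [|move: lt_l; rewrite mulrS]; lra.
exists (d *+ l.+1); last by apply: root_l; rewrite exprS dl mulr1.
by apply: le_trans leD; rewrite ler_norml; apply/andP; move: lt_l; rewrite mulrS; split; lra.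
Qed.

(** * Extremal roots and their limits *)

Lemma chebP_neq0 (F : numFieldType) k s n : chebP F k s n.+1 != 0.
Proof.
(* At [2 = 1 + 1^-1] each summand is 1 or 2, so the values cannot cancel. *)
have T2 m : 1 <= (chebT F m).[2].
  case: m => [|m]; first by rewrite hornerC.
  have := horner_chebT F 1 m.+1 (oner_neq0 _) isT.
  by rewrite !expr1n invr1 -[1 + 1]/2 => ->; rewrite ler1n.
have ge1 m : 1 <= (chebP F k s m.+1).[2].
  elim: m => [|m IH]; first by rewrite chebP1.
  by rewrite chebPS hornerD (le_trans IH) // lerDl (le_trans ler01) // T2.
by apply: contraTneq (ge1 n) => ->; rewrite horner0 ler10.
Qed.

Lemma seq_ex_max (R : realDomainType) (l : seq R) (x : R) : x \in l ->
  exists2 M, M \in l & {in l, forall y, y <= M}.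
Proof.
elim: l x => // a [|b l] IH x _.
  by exists a; rewrite ?mem_head // => y; rewrite inE => /eqP ->.
have [M Ml leM] := IH b (mem_head _ _).
have [leaM|ltMa] := leP a M.
  exists M; first by rewrite inE Ml orbT.
  by move=> y; rewrite inE => /predU1P[->|/leM].
exists a; first exact: mem_head.
by move=> y; rewrite inE => /predU1P[->|/leM/le_trans] //; apply; exact: ltW.
Qed.

Lemma ex_largest_root (R : realType) (p : {poly R}) (x : R) :
  p != 0 -> root p x -> exists M, is_largest_root p M.
Proof.
move=> p0 px; have rE y : root p y = (y \in rootsR p).
  by rewrite -(roots_on_rootsR p0) in_itv.
have [M Mp leM] := seq_ex_max _ _ _ (etrans (esym (rE x)) px).
by exists M; split=> [|y]; rewrite rE //; exact: leM.
Qed.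

Lemma ex_smallest_root (R : realType) (p : {poly R}) (x : R) :
  p != 0 -> root p x -> exists m, is_smallest_root p m.
Proof.
(* The reflection [x -> -x] exchanges smallest and largest roots. *)
move=> p0 px; have [||M [Mp leM]] := ex_largest_root R (p \Po (- 'X)) (- x).
- by rewrite comp_poly2_eq0 // size_polyN size_polyX.
- by rewrite root_comp hornerN hornerX opprK.
exists (- M); split=> [|y py]; first by move: Mp; rewrite root_comp hornerN hornerX.
by rewrite lerNl leM // root_comp hornerN hornerX opprK.
Qed.

Lemma chebP_root_cvg (R : realType) k s (t e : R) : 0 <= t -> 0 < e ->
  \forall n \near \oo, exists2 x, root (chebP R k s n) x & `|2 * cos t - x| <= e.
Proof.
move=> t0 e0.
have /cvgrPdist_le/(_ e e0) : 2 * cos x @[x --> t] --> 2 * cos t.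
  by apply: cvgMr; exact: continuous_cos.
move=> /nbhs_ballP[d /= d0 dP].
near=> n.
have n1 : (1 < n)%N by near: n; exact: nbhs_infty_gt.
(* [chebP_root_near] counts [n.+1] summands, hence its use at [n.-1]. *)
have n0 : (0 < n.-1)%N by lia.
have [a ta] := chebP_root_near R k s n.-1 t n0 t0.
rewrite prednK in ta *; last lia.
move=> ra; exists (2 * cos a) => //; apply: dP; rewrite /ball /=.
apply: le_lt_trans ta _; rewrite ltr_pdivrMr ?ltr0n; last lia.
by rewrite mulrC -ltr_pdivrMr //; near: n; exact: nbhs_infty_gtr.
Unshelve. all: by end_near. Qed.

Theorem mainTheorem1 (R : realType) (k s : nat) :
  (forall n : nat, (1 < n)%N ->
     hyperbolic (chebP R k s n) /\
     (forall x : R, root (chebP R k s n) x -> -2 <= x <= 2)) /\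
  (exists M m : nat -> R,
     (forall n : nat, (1 < n)%N ->
        is_largest_root (chebP R k s n) (M n) /\
        is_smallest_root (chebP R k s n) (m n)) /\
     M n @[n --> \oo] --> (2 : R) /\
     m n @[n --> \oo] --> (-2 : R)).
Proof.
have bnd n (x : R) : (1 < n)%N -> root (chebP R k s n) x -> -2 <= x <= 2.
  case: n => // n _ px.
  have [|a a2 [->] //] := chebP_complex_root R k s n x%:C%C.
  by rewrite -(map_chebP _ _ (real_complex R)) fmorph_root.
split=> [n n1|].
  split=> [z|x]; last exact: bnd.
  by case: n n1 => // n _; rewrite map_chebP => /chebP_complex_root[a _ ->].
have ex n : exists Mm : R * R, (1 < n)%N ->
    is_largest_root (chebP R k s n) Mm.1 /\ is_smallest_root (chebP R k s n) Mm.2.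
  (* For [n <= 1] extremal roots may fail to exist, and [(0, 0)] is a dummy value. *)
  case: n => [|[|n]]; try by exists (0, 0).
  have [a _ pa] := chebP_root_near R k s n.+1 0 isT (lexx _).
  have [M MP] := ex_largest_root _ _ _ (chebP_neq0 R k s n.+1) pa.
  have [m mP] := ex_smallest_root _ _ _ (chebP_neq0 R k s n.+1) pa.
  by exists (M, m).
have [f fP] := choice ex.
exists (fst \o f), (snd \o f); split=> [n n1|]; first exact: fP.
split; apply/cvgrPdist_le => e e0.
  near=> n.
  have n1 : (1 < n)%N by near: n; exact: nbhs_infty_gt.
  have [[rM leM] _] := fP n n1.
  (* The largest root is squeezed between a root within [e] of [2 * cos 0] and the upper bound 2;
     the angle [pi] serves likewise for the smallest root. *)
  have [x px] : exists2 x, root (chebP R k s n) x & `|2 * cos 0 - x| <= e.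
    by near: n; exact: chebP_root_cvg.
  have /andP[_ M2] := bnd _ _ n1 rM; have := leM _ px.
  by rewrite cos0 mulr1 /= !ler_norml => xM /andP[_ ?]; apply/andP; split; lra.
near=> n.
have n1 : (1 < n)%N by near: n; exact: nbhs_infty_gt.
have [_ [rm lem]] := fP n n1.
have [x px] : exists2 x, root (chebP R k s n) x & `|2 * cos pi - x| <= e.
  by near: n; apply: chebP_root_cvg => //; exact: pi_ge0.
have /andP[m2 _] := bnd _ _ n1 rm; have := lem _ px.
by rewrite cospi mulrN1 /= !ler_norml => mx /andP[? _]; apply/andP; split; lra.
Unshelve. all: by end_near. Qed.
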